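(* Consider the multiple pursuers/single evader game $(P^2)$ with one evader (labelled $1$) and $m\ge1$ pursuers (labelled $2,\ldots,m+1$), and its modifications $(P^2_i)$, $i=2,\ldots,m+1$, in which the target $\mathcal{T}=\mathcal{T}_2\cup\cdots\cup\mathcal{T}_{m+1}$ is replaced by $\mathcal{T}_i$ (all defined in the context). For $i=2,\ldots,m+1$ let $u_i$ be the upper value for $(P^2_i)$. Assume: (a) for $i=2,\ldots,m+1$, $u_i$ is a continuous viscosity solution on $(\mathbb{R}^2)^{m+1}\setminus\mathcal{T}_i$ of $$F^2(x^1,\ldots,x^{m+1},D_{x^1}u,\ldots,D_{x^{m+1}}u)=0; \qquad (\ast)$$ (b) for any $i,j\in\{2,\ldots,m+1\}$, $i\neq j$, and any $(x^1,\ldots,x^{m+1})\in(\mathbb{R}^2)^{m+1}\setminus\mathcal{T}$ such that $u_i(x^1,\ldots,x^{m+1})=u_j(x^1,\ldots,x^{m+1})$, the functions $u_i$ and $u_j$ are Lipschitz continuous on a neighbourhood of $(x^1,\ldots,x^{m+1})$. Then $$\bar u(x^1,\ldots,x^{m+1}):=\min\{u_2(x^1,\ldots,x^{m+1}),\ldots,u_{m+1}(x^1,\ldots,x^{m+1})\}$$ is a continuous viscosity solution of $(\ast)$ on $(\mathbb{R}^2)^{m+1}\setminus\mathcal{T}$.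
   Context: **Dynamics.** The state of player $i$ is $x^i=(x^i_1,x^i_2)\in\mathbb{R}^2$ (position, velocity), $i=1,\ldots,m+1$. The state equations are $$\dot x^1_1=x^1_2,\quad \dot x^1_2=-d_1(x^1_2)+a,\qquad \dot x^i_1=x^i_2,\quad \dot x^i_2=-d_i(x^i_2)+b_{i-1}\quad(i=2,\ldots,m+1),$$ where $d_i:\mathbb{R}\to\mathbb{R}$, $i=1,\ldots,m+1$, are given functions such that, for some constants $k_d>0$, $c_d>0$, one has $|d_i(y)-d_i(y')|\le k_d|y-y'|$ and $d_i(y)\le c_d$ for all $y,y'\in\mathbb{R}$ and all $i$. The controls are constrained by $|a|\le\alpha$ and $|b_i|\le\beta_i$, $i=1,\ldots,m$, where $\alpha,\beta_1,\ldots,\beta_m$ are positive constants with $\beta_i>\alpha+2c_d$ for $i=1,\ldots,m$. **Policies.** $\mathcal{A}$ is the set of measurable $a:[0,\infty)\to[-\alpha,\alpha]$ (a.e.), $\mathcal{B}$ the set of measurable $b=(b_1,\ldots,b_m)$ on $[0,\infty)$ with $b_i(t)\in[-\beta_i,\beta_i]$ a.e. $\Phi$ is the set of non-anticipative maps $\phi:\mathcal{B}\to\mathcal{A}$, i.e. maps such that for all $t'\ge0$ and $b,b'\in\mathcal{B}$, if $b=b'$ a.e. on $[0,t']$ then $\phi(b)=\phi(b')$ a.e. on $[0,t']$. **Targets and upper values.** For $i=2,\ldots,m+1$, $$\mathcal{T}_i=\{(x^1,\ldots,x^{m+1})\in(\mathbb{R}^2)^{m+1} : x^i_1\ge x^1_1\},\qquad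 \mathcal{T}=\mathcal{T}_2\cup\cdots\cup\mathcal{T}_{m+1}.$$ The game $(P^2)$ has target $\mathcal{T}$, and $(P^2_i)$ has target $\mathcal{T}_i$. The pay-off is the first entry time $\tau$ of the state trajectory into the target ($\tau=\inf\{t\ge0 : x(t)\in\text{target}\}$, $=+\infty$ if the target is never reached). The upper value at initial state $x$ is $\sup_{\phi\in\Phi}\inf_{b\in\mathcal{B}}\tau$, where $\tau$ is computed along the trajectory starting at $x$ with controls $(\phi(b),b)$. **Hamiltonian.** With $p^i=(p^i_1,p^i_2)\in\mathbb{R}^2$, $$F^2(x^1,\ldots,x^{m+1},p^1,\ldots,p^{m+1})=\sum_{i=1}^{m+1}\big(-p^i_1x^i_2+p^i_2d_i(x^i_2)\big)-\alpha|p^1_2|+\sum_{i=2}^{m+1}\beta_{i-1}|p^i_2|-1.$$ **Viscosity solutions.** For a continuous $u$ on an open set $\Omega\subset\mathbb{R}^N$ and $x\in\Omega$, $D^+u(x)=\{p\in\mathbb{R}^N:\limsup_{y\to x}\frac{u(y)-u(x)-p\cdot(y-x)}{|x-y|}\le0\}$ and $D^-u(x)=\{p\in\mathbb{R}^N:\liminf_{y\to x}\frac{u(y)-u(x)-p\cdot(y-x)}{|x-y|}\ge0\}$. A function $u:\Omega\to\mathbb{R}$ is a continuous viscosity solution of $F(x,Du)=0$ on $\Omega$ if it is continuous and, for every $x\in\Omega$, $F(x,p)\le0$ for all $p\in D^+u(x)$ and $F(x,p)\ge0$ for all $p\in D^-u(x)$. *)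

(* Defs.v *)
From mathcomp Require Import all_boot all_order all_algebra.
From mathcomp Require Import all_classical all_reals all_analysis.

Set Implicit Arguments.
Unset Strict Implicit.
Unset Printing Implicit Defensive.

Import Order.TTheory GRing.Theory Num.Theory.
Import numFieldNormedType.Exports.

Local Open Scope classical_set_scope.
Local Open Scope ring_scope.

Section Viscosity.
Context {R : realType} {k l : nat}.

(* All norms on the finite-dimensional space E are equivalent, and none of the
   notions below depends on the choice of one, so the library norm is used. *)
Local Notation E := 'M[R]_(k.+1, l.+1).

Definition dotp (p v : E) : R := \sum_i \sum_j p i j * v i j.

Definition diff_quotient (u : E -> R) (x p y : E) : \bar R :=
  ((u y - u x - dotp p (y - x)) / `|y - x|)%:E.

Definition superdiff (u : E -> R) (x : E) : set E :=
  [set p | (limf_esup (diff_quotient u x p) (x^') <= 0)%E].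

Definition subdiff (u : E -> R) (x : E) : set E :=
  [set p | (0 <= limf_einf (diff_quotient u x p) (x^'))%E].

Definition viscosity_solution (F : E -> E -> R) (Omega : set E) (u : E -> R) :=
  {within Omega, continuous u} /\
  forall x, Omega x ->
    (forall p, superdiff u x p -> F x p <= 0) /\
    (forall p, subdiff u x p -> 0 <= F x p).

(* The value of a game may be infinite: being a (real-valued) solution on
   Omega includes being finite there. *)
Definition eviscosity_solution (F : E -> E -> R) (Omega : set E)
    (u : E -> \bar R) :=
  (forall x, Omega x -> u x \is a fin_num) /\
  viscosity_solution F Omega (fine \o u).

End Viscosity.

Section Game.
Context {R : realType} {m : nat}.

(* Row ord0 is the state of the evader (player 1); row [pursuer i] is the state
   of player i + 2, whose control is the i-th component of b (i < m).
   Column ord0 is the position and column ord_max the velocity. *)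
Definition state := 'M[R]_(m.+1, 2).

Definition pursuer (i : 'I_m) : 'I_m.+1 := lift ord0 i.
Definition pos (x : state) (i : 'I_m.+1) : R := x i ord0.
Definition vel (x : state) (i : 'I_m.+1) : R := x i ord_max.

Definition policy := R -> R.
Definition policies := 'I_m -> policy.

Local Notation mu := (@lebesgue_measure R).

(* [measurable_fun] is Borel measurability; every Lebesgue measurable control
   agrees a.e. with a Borel one, and only a.e. classes matter below. *)
Definition admissible (alpha : R) (a : policy) :=
  measurable_fun (`[0, +oo[%classic : set R) a /\
  {ae mu, forall t, 0 <= t -> `|a t| <= alpha}.

Definition admissibles (beta : 'I_m -> R) (b : policies) :=
  forall i, admissible (beta i) (b i).

Definition nonanticipative (alpha : R) (beta : 'I_m -> R)
    (phi : policies -> policy) :=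
  (forall b, admissibles beta b -> admissible alpha (phi b)) /\
  forall t' b b', 0 <= t' -> admissibles beta b -> admissibles beta b' ->
    {ae mu, forall s, 0 <= s <= t' -> forall i, b i s = b' i s} ->
    {ae mu, forall s, 0 <= s <= t' -> phi b s = phi b' s}.

Definition control (a : policy) (b : policies) (i : 'I_m.+1) : policy :=
  if unlift ord0 i is Some j then b j else a.

(* Caratheodory solutions on [0, +oo[ of the state equations, in integral
   form. *)
Definition trajectory (d : 'I_m.+1 -> R -> R) (x0 : state)
    (a : policy) (b : policies) (x : R -> state) :=
  {within (`[0, +oo[%classic : set R), continuous x} /\
  forall t, 0 <= t -> forall i,
    pos (x t) i = pos x0 i + \int[mu]_(s in `[0, t]) vel (x s) i /\
    vel (x t) i = vel x0 i +
      \int[mu]_(s in `[0, t]) (- d i (vel (x s) i) + control a b i s).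

Definition entry_time (T : set state) (x : R -> state) : \bar R :=
  ereal_inf [set t%:E | t in [set t | 0 <= t /\ T (x t)]].

(* For admissible controls the trajectory exists and is unique when the d i are
   Lipschitz, so the infimum below is the infimum over b alone. *)
Definition upper_value (d : 'I_m.+1 -> R -> R) (alpha : R) (beta : 'I_m -> R)
    (T : set state) (x0 : state) : \bar R :=
  ereal_sup [set ereal_inf [set tau | exists b x,
      [/\ admissibles beta b, trajectory d x0 (phi b) b x
        & tau = entry_time T x]]
    | phi in nonanticipative alpha beta].

Definition target_of (i : 'I_m) : set state :=
  [set x | pos x ord0 <= pos x (pursuer i)].

Definition target : set state := \bigcup_i target_of i.

Definition hamiltonian (d : 'I_m.+1 -> R -> R) (alpha : R) (beta : 'I_m -> R)
    (x p : state) : R :=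
  \sum_i (- (p i ord0 * vel x i) + p i ord_max * d i (vel x i))
  - alpha * `|p ord0 ord_max|
  + \sum_i beta i * `|p (pursuer i) ord_max| - 1.

Definition min_value (u : 'I_m -> state -> \bar R) (x : state) : \bar R :=
  \big[Order.min/+oo%E]_i u i x.

End Game.

Arguments state : clear implicits.

(* Main.v *)
Require Import Defs.
From mathcomp Require Import all_boot all_order all_algebra.
From mathcomp Require Import all_classical all_reals all_analysis.
From mathcomp Require Import measurable_realfun ring lra.
Set Implicit Arguments.
Unset Strict Implicit.
Unset Printing Implicit Defensive.

Import Order.TTheory GRing.Theory Num.Theory.
Import numFieldNormedType.Exports.
Local Open Scope classical_set_scope.
Local Open Scope ring_scope.

(** The supersolution property and continuity pass from the [u i] to their
    minimum for general reasons: at a point where [u i] attains the minimum,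
    every subgradient of the minimum is a subgradient of [u i]
    ([subdiff_le], [pointwise_min_continuous]).

    The subsolution property does not, because the Hamiltonian is not convex in
    the evader's momentum.  What makes it true is that fleeing at full thrust
    [alpha] is the evader's best answer to each pursuer simultaneously: the
    players move on a line, each with its own scalar equation, and more thrust
    always yields more speed and more distance ([motion_le]).  So let all
    players start from [x] with constant accelerations for a short time [t], the
    evader using at least [alpha].  Whatever strategy the evader really plays,
    the true evader stays behind this reference evader, hence
    [u i x <= t + u i y] at the point [y] reached, for every [i]
    ([value_along_uniform_path]).  The same inequality holds for the minimum,
    whichever pursuer is optimal at [y] ([min_value_along_uniform_path]).
    Dividing by [t] and letting [t] tend to 0, a supergradient [p] of the minimum
    satisfies [0 <= 1 + p . f] for the corresponding initial direction [f]
    ([superdiff_along_uniform_path]).  The evader control [alpha] and the pursuer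
    controls [- beta j * sg p] turn this into the sign of the Hamiltonian
    ([hamiltonian_le0]).

    Differential equations with measurable right-hand sides never have to be
    solved on the way.  The accelerated paths are explicit, their controls being
    whatever compensates the drag ([motion_uniform]).  For the evader's answer
    to a given pursuit, existence of a trajectory is read off from the
    finiteness of the value ([finite_value_trajectory]). *)

(** * Time translation of Lebesgue integrals *)

Section Shift.
Context {R : realType}.
Local Notation mu := (@lebesgue_measure R).
Local Notation shift t :=
  ((fun s : R => s - t) : measurableTypeR R -> measurableTypeR R).
Implicit Types (f g : R -> R) (t r : R).

Lemma measurable_shift t :
  measurable_fun [set: measurableTypeR R] (shift t).
Proof. exact: measurable_funB. Qed.

Lemma lebesgue_measure_shift t (A : set R) : measurable A ->
  pushforward mu (shift t) A = mu A.
Proof.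
(* [mt] makes the pushforward a measure. *)
have mt := measurable_shift t.
move=> mA; apply/esym/lebesgue_measure_unique => //= _ [[a b]] _ <-.
rewrite /pushforward.
have -> : (fun s => s - t) @^-1` `]a, b]%classic = `]a + t, b + t]%classic.
  by apply/seteqP; split => s /=; rewrite !in_itv/= ltrBrDr lerBlDr.
rewrite !lebesgue_measure_itv/= !lte_fin ltrD2r.
by case: ifP => // _; rewrite -!EFinB; congr _%:E; ring.
Qed.

Lemma ae_shift t (P : R -> Prop) :
  {ae mu, forall s, P s} -> {ae mu, forall s, P (s - t)}.
Proof.
move=> [N [mN N0 PN]]; exists ((fun s => s - t) @^-1` N); split.
- rewrite -[X in measurable X]setTI; exact: measurable_shift.
- by have := lebesgue_measure_shift t mN; rewrite /pushforward N0.
- by move=> s /= nP; exact: PN.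
Qed.

Lemma shift_preimage t r :
  (fun s : R => s - t) @^-1` `[0, r]%classic = `[t, t + r]%classic.
Proof.
by apply/seteqP; split => s /=; rewrite !in_itv/= subr_ge0 lerBlDl.
Qed.

Lemma integrable_shift t r f : mu.-integrable `[0, r] (EFin \o f) ->
  mu.-integrable `[t, t + r] (EFin \o (fun s => f (s - t))).
Proof.
move=> /integrableP[mf fi]; apply/integrableP; split.
  have mt := @measurable_funTS _ _ _ _ `[t, t+r]%classic _ (measurable_shift t).
  have := measurable_comp _ _ mf mt.
  by apply => //; rewrite -shift_preimage => _ [s ? <-].
rewrite -shift_preimage.
rewrite -(@ge0_integral_pushforward _ _ _ _ _ _ (measurable_shift t) mu
  `[0, r]%classic (fun s => `|(f s)%:E|)%E) //=.
- rewrite (@eq_measure_integral _ _ _ _ mu)//; first exact: measurable_shift.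
  by move=> ? A mA _; exact: lebesgue_measure_shift.
- apply/measurable_EFinP/measurableT_comp => //; exact/measurable_EFinP.
Qed.

Lemma Rintegral_shift t r f : mu.-integrable `[0, r] (EFin \o f) ->
  \int[mu]_(s in `[t, t + r]) f (s - t) = \int[mu]_(s in `[0, r]) f s.
Proof.
move=> fi; have /integrableP[mf _] := fi; rewrite /Rintegral; congr fine.
rewrite [RHS]integral_mkcond.
have nuE (F : measurableTypeR R -> \bar R) :
    (\int[pushforward mu (shift t)]_x F x = \int[mu]_x F x)%E.
  rewrite (@eq_measure_integral _ _ _ _ mu)//; first exact: measurable_shift.
  by move=> ? A mA _; exact: lebesgue_measure_shift.
rewrite -nuE (integral_pushforward (measurable_shift t)) //=.
- rewrite preimage_setT [LHS]integral_mkcond; apply: eq_integral => s _ /=.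
  by rewrite -shift_preimage.
- exact/(measurable_restrictT _ _).1.
- rewrite preimage_setT.
  have := @integrable_shift t r f fi.
  rewrite integrable_mkcond // -shift_preimage; apply: eq_integrable => // s _ //=.
Qed.

End Shift.

(** * Concatenation of locally integrable functions of time *)

Section Concat.
Context {R : realType}.
Local Notation mu := (@lebesgue_measure R).
Implicit Types (f g : R -> R) (t r T : R).

(** Weaker than integrability on the half-line, and what the integral form of
    the state equations needs: constant controls have to qualify. *)
Definition segment_integrable f := forall T, mu.-integrable `[0, T] (EFin \o f).

Definition concat t f g : R -> R := fun s => if s <= t then f s else g (s - t).

Lemma integrable_setU (A B : set R) f : measurable A -> measurable B ->
  [disjoint A & B] -> mu.-integrable A (EFin \o f) ->
  mu.-integrable B (EFin \o f) -> mu.-integrable (A `|` B) (EFin \o f).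
Proof.
move=> mA mB AB /integrableP[mfA fA] /integrableP[mfB fB].
have mf : measurable_fun (A `|` B) (EFin \o f) by apply/measurable_funU.
apply/integrableP; split => //; rewrite ge0_integral_setU //.
  by rewrite lte_add_pinfty.
apply/measurable_EFinP/measurableT_comp => //; exact/measurable_EFinP.
Qed.

(** The second half of the integral is brought back to time 0 by translation
    invariance; this is how an autonomous system forgets its starting time. *)
Lemma Rintegral_concat t f g T : 0 <= t -> 0 <= T ->
  mu.-integrable `[0, t] (EFin \o f) -> mu.-integrable `[0, T] (EFin \o g) ->
  mu.-integrable `[0, t + T] (EFin \o concat t f g) /\
  \int[mu]_(s in `[0, t + T]) concat t f g s =
    \int[mu]_(s in `[0, t]) f s + \int[mu]_(s in `[0, T]) g s.
Proof.
move=> t0 T0 fi gi.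
have split_itv : `[0, t + T]%classic = `[0, t]%classic `|` `]t, t + T]%classic.
  by rewrite (@itv_bndbnd_setU _ _ _ (BRight t)) // bnd_simp // lerDl.
have fi' : mu.-integrable `[0, t] (EFin \o concat t f g).
  apply: eq_integrable fi => // s; rewrite inE /= in_itv/= => /andP[_ st].
  by rewrite /concat st.
have sgi : mu.-integrable `]t, t + T] (EFin \o (fun s => g (s - t))).
  apply: integrableS (integrable_shift t gi) => //.
  by apply: subset_itvr; rewrite bnd_simp.
have gi' : mu.-integrable `]t, t + T] (EFin \o concat t f g).
  apply: eq_integrable sgi => // s; rewrite inE /= in_itv/= => /andP[st _].
  by rewrite /concat leNgt st.
have dis : [disjoint `[0, t]%classic & `]t, t + T]%classic].
  apply/disj_setPRL => s /=; rewrite !in_itv/= => /andP[st _].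
  by move=> /andP[_ ?]; lra.
have fgi : mu.-integrable `[0, t + T] (EFin \o concat t f g).
  by rewrite split_itv; apply: integrable_setU.
split => //; rewrite split_itv Rintegral_setU -?split_itv //.
congr (_ + _).
  apply: eq_Rintegral => s; rewrite inE /= in_itv/= => /andP[_ st].
  by rewrite /concat st.
rewrite -(Rintegral_shift t gi) -Rintegral_itv_obnd_cbnd //.
apply: eq_Rintegral => s; rewrite inE /= in_itv/= => /andP[st _].
by rewrite /concat leNgt st.
Qed.

Lemma continuous_segment_integrable (f : R -> R) :
  {within `[0, +oo[, continuous f} -> segment_integrable f.
Proof.
move=> fc T; apply: continuous_compact_integrable; first exact: segment_compact.
by apply: continuous_subspaceW fc; apply: subset_itvl; rewrite bnd_simp.
Qed.

Lemma segment_integrable_oc (f : R -> R) s : 0 <= s -> segment_integrable f ->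
  forall c, mu.-integrable `]s, c] (EFin \o f).
Proof.
move=> s0 fi c; apply: integrableS (fi c) => //.
by apply: subset_itvr; rewrite bnd_simp.
Qed.

(** The nonnegative function [`|g - f|] agrees almost everywhere with [g - f],
    which reduces the claim to a pointwise sign. *)
Lemma ae_le_Rintegral (D : set R) (f g : R -> R) : measurable D ->
  mu.-integrable D (EFin \o f) -> mu.-integrable D (EFin \o g) ->
  {ae mu, forall s, D s -> f s <= g s} ->
  \int[mu]_(s in D) f s <= \int[mu]_(s in D) g s.
Proof.
move=> mD fi gi fg; rewrite -subr_ge0 -RintegralB //.
have /integrableP[mf _] := fi; have /integrableP[mg _] := gi.
have mgf : measurable_fun D (fun s => g s - f s).
  by apply: measurable_funB; exact/measurable_EFinP.
rewrite (_ : Rintegral _ _ _ = \int[mu]_(s in D) `|g s - f s|).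
  by apply: Rintegral_ge0.
congr fine; apply: ae_eq_integral => //.
- exact/measurable_EFinP.
- exact/measurable_EFinP/measurableT_comp.
- move: fg; apply: (@filterS _ (almost_everywhere mu)) => s fgs Ds.
  by rewrite ger0_norm ?subr_ge0 ?fgs.
Qed.

Lemma segment_integrable_concat t f g : 0 <= t ->
  segment_integrable f -> segment_integrable g ->
  segment_integrable (concat t f g).
Proof.
move=> t0 fi gi T; have [Tt|tT] := leP T t.
  apply: eq_integrable (fi T) => // s; rewrite inE /= in_itv/= => /andP[_ sT].
  by rewrite /concat (le_trans sT Tt).
rewrite (_ : T = t + (T - t)); last by ring.
by apply: (Rintegral_concat t0 _ (fi _) (gi _)).1; rewrite subr_ge0 ltW.
Qed.

Lemma within_segments_continuous f :
  (forall T, 0 <= T -> {within `[0, T], continuous f}) ->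
  {within `[0, +oo[, continuous f}.
Proof.
move=> fc; apply/subspace_continuousP => x; rewrite /= in_itv/= andbT => x0.
have x1 : 0 <= x + 1 by rewrite addr_ge0.
have /subspace_continuousP/(_ x) := fc _ x1.
rewrite /= in_itv /= x0 lerDl ler01 => /(_ isT); apply: cvg_trans.
apply: cvg_app => A /= HA.
have {}HA : \forall y \near x, `[0, x + 1]%classic y -> A y := HA.
change (\forall y \near x, `[0, +oo[%classic y -> A y).
near=> y; rewrite /= in_itv/= andbT => y0.
apply: (near HA y) => //; rewrite /= in_itv/= y0/=.
by apply: ltW; near: y; apply: lt_nbhsl; rewrite ltrDl.
Unshelve. all: by end_near. Qed.

Lemma integral_continuous v0 f : segment_integrable f ->
  {within `[0, +oo[, continuous (fun t => v0 + \int[mu]_(s in `[0, t]) f s)}.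
Proof.
move=> fi; apply: within_segments_continuous => T T0.
have c := parameterized_integral_continuous T0 (fi T).
by move=> x; apply: cvgD; [exact: cvg_cst|exact: c].
Qed.

End Concat.

(** * Scalar motions and their comparison *)

Section Gronwall.
Context {R : realType}.

(** The increments of [w] are controlled only on intervals where [w] is
    positive.  If [w T] were positive, look at [w] just after its last time
    [t0] of nonpositivity: over a length at most [1 / (2 k)] its maximum [M]
    would satisfy [M <= k * M / (2 * k) = M / 2]. *)
Lemma gronwall_le0 (w : R -> R) (k T : R) : 0 < k -> 0 <= T ->
  {within `[0, T], continuous w} -> w 0 <= 0 ->
  (forall s c M : R, 0 <= s -> s <= c -> c <= T ->
    (forall r : R, s < r <= c -> 0 < w r <= M) -> w c - w s <= k * M * (c - s)) ->
  w T <= 0.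
Proof.
move=> k0 T0 wc w0 inc; rewrite leNgt; apply/negP => wT.
pose E := [set r : R | 0 <= r <= T /\ w r <= 0].
have supE : has_sup E.
  split; first by exists 0; split; rewrite ?lexx ?T0.
  by exists T => r [/andP[]].
(* The last time before [T] at which [w] is not positive. *)
set t0 := sup E.
have t00 : 0 <= t0 by apply: sup_upper_bound => //; split; rewrite ?lexx ?T0.
have t0T : t0 <= T by apply: sup_le_ub => //; [case: supE|move=> r [/andP[]]].
have wpos r : t0 < r <= T -> 0 < w r.
  move=> /andP[t0r rT]; rewrite ltNge; apply/negP => wr.
  have : r <= t0.
    apply: sup_upper_bound => //; split => //.
    by rewrite rT (le_trans t00 (ltW t0r)).
  by rewrite leNgt t0r.
have wt0 : w t0 <= 0.
  rewrite leNgt; apply/negP => wt0.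
  have /subspace_continuousP/(_ t0) := wc.
  rewrite /= in_itv/= t00 t0T => /(_ isT)/cvgrPdist_lt/(_ _ wt0).
  rewrite near_withinE => /nbhs_ballP[e /= e0 He].
  have [r [/andP[r0 rT] wr] t0r] := sup_adherent e0 supE.
  have rt0 : r <= t0 by apply: sup_upper_bound => //; split; rewrite ?r0.
  have := He r; rewrite /ball/= ger0_norm ?subr_ge0// ltrBlDl -ltrBlDr => /(_ t0r).
  rewrite in_itv/= r0 rT => /(_ isT); rewrite ltr_norml /from_subspace => /andP[_]; lra.
have t0T' : t0 < T.
  by rewrite lt_neqAle t0T andbT; apply/eqP => H; move: wt0; rewrite H leNgt wT.
pose h := (2 * k)^-1; have h0 : 0 < h by rewrite invr_gt0; lra.
pose t1 := Num.min T (t0 + h).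
have t01 : t0 < t1 by rewrite /t1 lt_min t0T' ltrDl.
have t1T : t1 <= T by rewrite /t1 ge_min lexx.
have t1h : t1 <= t0 + h by rewrite /t1 ge_min lexx orbT.
have wc1 : {within `[t0, t1], continuous w}.
  by apply: continuous_subspaceW wc => r /=; rewrite !in_itv/=; lra.
have [e et Me] := EVT_max (ltW t01) wc1.
move: et; rewrite in_itv/= => /andP[t0e et1].
have we : 0 < w e.
  apply: lt_le_trans (Me t1 _); last by rewrite in_itv/= lexx ltW.
  by apply: wpos; rewrite t01.
have : w e - w t0 <= k * w e * (e - t0).
  apply: inc => //; first lra.
  move=> r /andP[r0 re]; rewrite wpos ?Me// ?in_itv/=; lra.
have : k * w e * (e - t0) <= k * w e * h.
  by rewrite ler_pM2l ?mulr_gt0//; lra.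
have -> : k * w e * h = w e / 2 by rewrite /h; field; rewrite gt_eqF.
lra.
Qed.

End Gronwall.

Section Motion.
Context {R : realType}.
Local Notation mu := (@lebesgue_measure R).
Variable drag : R -> R.
Implicit Types (a q v : R -> R) (t c : R).

(** One row of [trajectory], for a single player.  The two integrability
    clauses keep the real-valued integrals from taking their default value, so
    that continuity of [q] and [v] is a consequence. *)
Definition motion (q0 v0 : R) a q v :=
  [/\ segment_integrable v,
      segment_integrable (fun s => - drag (v s) + a s) &
      forall t, 0 <= t ->
        q t = q0 + \int[mu]_(s in `[0, t]) v s /\
        v t = v0 + \int[mu]_(s in `[0, t]) (- drag (v s) + a s)].

Lemma motion_continuous (q0 v0 : R) a q v : motion q0 v0 a q v ->
  {within `[0, +oo[, continuous q} /\ {within `[0, +oo[, continuous v}.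
Proof.
move=> [vi di E]; split.
- apply: (@subspace_eq_continuous R _ R _ _ _ (integral_continuous (v0 := q0) vi)) => t.
  rewrite inE /= in_itv/= andbT => /E[H _]; exact: esym H.
- apply: (@subspace_eq_continuous R _ R _ _ _ (integral_continuous (v0 := v0) di)) => t.
  rewrite inE /= in_itv/= andbT => /E[_ H]; exact: esym H.
Qed.

Lemma motion_concat t (q0 v0 : R) a1 q1 v1 a2 q2 v2 : 0 <= t ->
  motion q0 v0 a1 q1 v1 -> motion (q1 t) (v1 t) a2 q2 v2 ->
  motion q0 v0 (concat t a1 a2) (concat t q1 q2) (concat t v1 v2).
Proof.
move=> t0 [v1i d1i E1] [v2i d2i E2].
have dE : (fun s => - drag (concat t v1 v2 s) + concat t a1 a2 s) =
    concat t (fun s => - drag (v1 s) + a1 s) (fun s => - drag (v2 s) + a2 s).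
  by apply/funext => s; rewrite /concat; case: ifP.
split; rewrite ?dE; try exact: segment_integrable_concat.
move=> r r0; rewrite {1 3}/concat; case: ifPn => rt.
  have [-> ->] := E1 _ r0.
  split; congr (_ + _); apply: eq_Rintegral => s;
    by rewrite inE /= in_itv/= => /andP[_ sr]; rewrite /concat (le_trans sr rt).
have rt0 : 0 <= r - t by rewrite subr_ge0 ltW// ltNge.
have [-> ->] := E2 _ rt0; have [-> ->] := E1 _ t0.
have -> : `[0, r] = `[0, t + (r - t)] :> interval R by rewrite addrC subrK.
rewrite (Rintegral_concat t0 rt0 (v1i _) (v2i _)).2.
by rewrite (Rintegral_concat t0 rt0 (d1i _) (d2i _)).2 !addrA.
Qed.

(** A velocity of constant slope [c] solves the state equation: the control
    only has to compensate the drag.  This gives explicit motions without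
    solving a differential equation. *)
Lemma motion_uniform (q0 v0 : R) c :
  motion q0 v0 (fun s => c + drag (v0 + s * c))
    (fun s => q0 + (s * v0 + s ^+ 2 / 2 * c)) (fun s => v0 + s * c).
Proof.
have vc : continuous (fun s : R => v0 + s * c).
  by move=> s; apply: cvgD; [exact: cvg_cst|apply: cvgMr_tmp; exact: cvg_id].
have dE : (fun s => - drag (v0 + s * c) + (c + drag (v0 + s * c))) = cst c.
  by apply/funext => s /=; ring.
split.
- exact/continuous_segment_integrable/continuous_subspaceT.
- rewrite dE; apply/continuous_segment_integrable/continuous_subspaceT.
  exact: cst_continuous.
move=> t t0; rewrite dE; split; congr (_ + _).
- move: t0; rewrite le_eqVlt => /predU1P[<-|t0].
    by rewrite set_itv1 Rintegral_set1; ring.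
  pose F (s : R) := s * v0 + s ^+ 2 / 2 * c.
  have dF (s : R) : is_derive s (1 : R) F (v0 + s * c).
    apply: is_derive_eq; by rewrite /GRing.scale/=; field.
  have cF : continuous F.
    by move=> s; apply/differentiable_continuous/derivable1_diffP; case: (dF s).
  rewrite /Rintegral (@continuous_FTC2 _ _ F) //=.
  + by rewrite /F; ring.
  + exact/continuous_subspaceT.
  + split.
    * by move=> s _; case: (dF s).
    * exact/cvg_at_right_filter/cF.
    * exact/cvg_at_left_filter/cF.
  + by move=> s _; rewrite derive1E; case: (dF s).
- rewrite Rintegral_cst //= lebesgue_measure_itv /= lte_fin.
  case: ifPn => [_|]; first by rewrite /= oppr0 addr0 mulrC.
  by rewrite -leNgt => ?; rewrite (_ : t = 0) ?mul0r ?mulr0//; lra.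
Qed.

Lemma motion_increment (q0 v0 : R) a q v s c : motion q0 v0 a q v ->
  0 <= s -> s <= c ->
  v c - v s = \int[mu]_(r in `]s, c]) (- drag (v r) + a r).
Proof.
move=> [_ di E] s0 sc; have [_ ->] := E s s0; have [_ ->] := E c (le_trans s0 sc).
rewrite -(Rintegral_itvB (di c)) ?bnd_simp //; ring.
Qed.

(** More thrust means more speed, hence more distance.  While the smaller
    control yields the larger velocity, the drag makes the gap grow at rate at
    most [k] times the gap, so that [gronwall_le0] closes the gap. *)
Lemma motion_le k (q0 v0 : R) a1 q1 v1 a2 q2 v2 : 0 < k ->
  (forall y y', `|drag y - drag y'| <= k * `|y - y'|) ->
  motion q0 v0 a1 q1 v1 -> motion q0 v0 a2 q2 v2 ->
  {ae mu, forall s, 0 <= s -> a1 s <= a2 s} ->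
  forall t, 0 <= t -> v1 t <= v2 t /\ q1 t <= q2 t.
Proof.
move=> k0 dlip m1 m2 a12.
have v12 t : 0 <= t -> v1 t <= v2 t.
  move=> t0; rewrite -subr_le0.
  apply: (@gronwall_le0 _ (fun s : R => v1 s - v2 s) k t) => //.
  - have sub : `[0, t]%classic `<=` `[0, +oo[%classic.
      by apply: subset_itvl; rewrite bnd_simp.
    move=> s; apply: cvgB.
      exact: (continuous_subspaceW sub (motion_continuous m1).2).
    exact: (continuous_subspaceW sub (motion_continuous m2).2).
  - have [_ _ /(_ _ (lexx 0))[_ ->]] := m1; have [_ _ /(_ _ (lexx 0))[_ ->]] := m2.
    by rewrite !set_itv1 !Rintegral_set1; lra.
  - move=> s c M s0 sc ct pos.
    rewrite [leLHS](_ : _ = (v1 c - v1 s) - (v2 c - v2 s)); last by ring.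
    rewrite (motion_increment m1) // (motion_increment m2) //.
    have mI : measurable `]s, c]%classic by [].
    have [_ /(segment_integrable_oc s0)/(_ c) d1 _] := m1.
    have [_ /(segment_integrable_oc s0)/(_ c) d2 _] := m2.
    have Mi : mu.-integrable `]s, c] (EFin \o cst (k * M)).
      apply: segment_integrable_oc s0 _ _.
      apply/continuous_segment_integrable/continuous_subspaceT.
      exact: cst_continuous.
    have -> : k * M * (c - s) = \int[mu]_(r in `]s, c]) cst (k * M) r.
      rewrite Rintegral_cst //= lebesgue_measure_itv /= lte_fin.
      case: ltP => [_|cs]; first by rewrite -EFinB.
      by rewrite /= (_ : c - s = 0) ?mulr0//; lra.
    rewrite lerBlDl -RintegralD //.
    apply: ae_le_Rintegral => //; first by apply: eq_integrable (integrableD _ d2 Mi).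
    move: a12; apply: (@filterS _ (almost_everywhere mu)) => r ar.
    rewrite /= in_itv/= => /andP[sr rc].
    have /andP[w0 wM] : 0 < v1 r - v2 r <= M by apply: pos; rewrite sr rc.
    have := ar (le_trans s0 (ltW sr)).
    have := dlip (v1 r) (v2 r); rewrite (gtr0_norm w0) ler_norml => /andP[dl _].
    have : k * (v1 r - v2 r) <= k * M by rewrite ler_pM2l.
    lra.
move=> t t0; split; first exact: v12.
have [v1i _ /(_ _ t0)[-> _]] := m1; have [v2i _ /(_ _ t0)[-> _]] := m2.
rewrite lerD2l; apply: le_Rintegral => // s.
by rewrite /= in_itv/= => /andP[s0 _]; exact: v12.
Qed.

End Motion.

(** * Controls and trajectories of the game *)

Section Admissible.
Context {R : realType}.
Local Notation mu := (@lebesgue_measure R).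
Implicit Types (a : R -> R) (gamma t : R).

Lemma admissible_segment_integrable gamma a :
  admissible gamma a -> segment_integrable a.
Proof.
move=> [ma aE] T.
have sub : `[0, T]%classic `<=` `[0, +oo[%classic.
  by apply: subset_itvl; rewrite bnd_simp.
have maT : measurable_fun (`[0, T]%classic : set R) (EFin \o a).
  by apply/measurable_EFinP; apply: measurable_funS ma.
apply/integrableP; split => //.
apply: le_lt_trans.
  apply: (integral_le_bound `|gamma|%:E) => //.
  move: aE; apply: (@filterS _ (almost_everywhere mu)) => s aE.
  rewrite /= in_itv/= => /andP[/aE as0 _].
  by rewrite lee_fin (le_trans as0)// ler_norm.
rewrite /= lebesgue_measure_itv /= lte_fin; case: ifPn => _.
  by rewrite -EFinB -EFinM ltry.
by rewrite mule0 ltry.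
Qed.

Lemma admissible_concat gamma t a1 a2 : 0 <= t -> continuous a1 ->
  (forall s, 0 <= s <= t -> `|a1 s| <= gamma) -> admissible gamma a2 ->
  admissible gamma (concat t a1 a2).
Proof.
move=> t0 ca1 a1g [ma2 a2g]; split.
  have -> : `[0, +oo[%classic = `[0, t]%classic `|` `]t, +oo[%classic :> set R.
    by rewrite (@itv_bndbnd_setU _ _ _ (BRight t)) // bnd_simp.
  apply/measurable_funU => //; split.
    apply: (@eq_measurable_fun _ _ _ _ _ a1).
      by move=> s; rewrite inE /= in_itv/= => /andP[_ st]; rewrite /concat st.
    apply: measurable_funTS; exact: continuous_measurable_fun.
  apply: (@eq_measurable_fun _ _ _ _ _ (a2 \o (fun s => s - t))).
    by move=> s; rewrite inE /= in_itv/= andbT => st; rewrite /concat leNgt st.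
  apply: measurable_comp ma2 _ => //.
    by move=> _ [s /= + <-]; rewrite !in_itv/= !andbT subr_ge0 => /ltW.
  exact/measurable_funTS/measurable_funB.
have := ae_shift t a2g.
apply: (@filterS _ (almost_everywhere mu)) => s a2s s0.
rewrite /concat; case: ifPn => st; first by apply: a1g; rewrite s0 st.
by apply: a2s; rewrite subr_ge0 ltW// ltNge.
Qed.

Lemma admissible_cst gamma (a : R) : `|a| <= gamma -> admissible gamma (cst a).
Proof. by move=> ag; split => //; apply: aeW. Qed.

End Admissible.

Lemma ord2_cases (j : 'I_2) : j = ord0 \/ j = ord_max.
Proof. by case: j => -[|[|//]] ?; [left|right]; exact: val_inj. Qed.

Section Trajectory.
Context {R : realType} {m : nat}.
Local Notation mu := (@lebesgue_measure R).
Variable d : 'I_m.+1 -> R -> R.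
Hypothesis d_continuous : forall i, continuous (d i).

Lemma trajectory_motion gamma x0 a b x i :
  trajectory d x0 a b x -> admissible gamma (control a b i) ->
  motion (d i) (pos x0 i) (vel x0 i) (control a b i)
    (fun t => pos (x t) i) (fun t => vel (x t) i).
Proof.
move=> [cx E] adm; have xc j : {within `[0, +oo[, continuous (fun t => x t i j)}.
  apply: (@within_continuous_comp _ _ _ _ x (fun M : 'M[R]_(_, _) => M i j)) => // M _.
  exact: coord_continuous.
have vc : {within `[0, +oo[, continuous (fun t => - d i (vel (x t) i))}.
  apply: (@within_continuous_comp _ _ _ _ _ (fun v => - d i v)) (xc ord_max).
  by move=> v _; apply: cvgN; exact: d_continuous.
split => //.
- exact: continuous_segment_integrable (xc ord_max).
- move=> T; apply: eq_integrable (integrableD _ (continuous_segment_integrable vc T)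
    (admissible_segment_integrable adm T)) => //.
- by move=> t t0; exact: E.
Qed.

Lemma motion_trajectory x0 a b x :
  (forall i, motion (d i) (pos x0 i) (vel x0 i) (control a b i)
    (fun t => pos (x t) i) (fun t => vel (x t) i)) ->
  trajectory d x0 a b x.
Proof.
move=> M; split; last by move=> t t0 i; have [_ _ /(_ t t0)] := M i.
move=> t; apply/cvgrPdist_lt => e e0.
have coordc (ij : 'I_m.+1 * 'I_2) :
    {within `[0, +oo[, continuous (fun t => x t ij.1 ij.2)}.
  case: ij => i j; have [qc vc] := motion_continuous (M i) => /=.
  have [->|->] := ord2_cases j.
  - exact: qc.
  - exact: vc.
have FF : ProperFilter (nbhs t) := @nbhs_pfilter _ t.
have : \forall s \near t, forall ij : 'I_m.+1 * 'I_2,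
    `|x t ij.1 ij.2 - x s ij.1 ij.2| < e.
  apply: filter_forall => ij.
  by have /cvgrPdist_lt/(_ _ e0) := coordc ij t.
apply: filterS => s xts.
rewrite [ltLHS]/Num.norm /= mx_normrE; apply/bigmax_ltP; split => // ij _.
by rewrite !mxE; exact: xts.
Qed.

Lemma trajectory_start x0 a b x : trajectory d x0 a b x -> x 0 = x0.
Proof.
move=> [_ /(_ 0 (lexx _)) E]; apply/matrixP => i j.
have [] := E i; rewrite !set_itv1 !Rintegral_set1 !addr0.
by have [->|->] := ord2_cases j.
Qed.

End Trajectory.

(** * Values along a path *)

Section Value.
Context {R : realType} {m : nat}.
Local Notation mu := (@lebesgue_measure R).
Variables (d : 'I_m.+1 -> R -> R) (k_d alpha : R) (beta : 'I_m -> R).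
Hypothesis k_d_gt0 : 0 < k_d.
Hypothesis d_lip : forall i y y', `|d i y - d i y'| <= k_d * `|y - y'|.
Hypothesis alpha_ge0 : 0 <= alpha.

Local Notation u i := (upper_value d alpha beta (target_of i)).

Lemma lipschitz_drift_continuous i : continuous (d i).
Proof.
move=> y; apply/cvgrPdist_lt => e e0; near=> z.
apply: le_lt_trans (d_lip _ _ _) _.
rewrite -ltr_pdivlMl //; near: z.
by apply: (@cvgr_dist_lt _ _ _ (nbhs y) _ id y) => //; rewrite mulr_gt0 ?invr_gt0.
Unshelve. all: by end_near. Qed.

(** The state reached at time [t] from [x] when every player [i] keeps the
    constant acceleration [c i]. *)
Definition uniform_path (x : state R m) (c : 'I_m.+1 -> R) (t : R) : state R m :=
  \matrix_(i, j) if j == ord0 then pos x i + (t * vel x i + t ^+ 2 / 2 * c i)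
                 else vel x i + t * c i.

Lemma nonanticipative_cst a : admissible alpha a ->
  nonanticipative alpha beta (cst a).
Proof. by move=> adm; split => // *; apply: aeW. Qed.

(** Finiteness of the value already contains an existence theorem for the state
    equations.  Against the strategy that always answers [a], an infinite
    infimum is avoided only if some [b] admits a trajectory; its evader row then
    solves the evader's equation for the control [a]. *)
Lemma finite_value_trajectory (T : set (state R m)) x a :
  (upper_value d alpha beta T x < +oo)%E -> admissible alpha a ->
  exists b y, admissibles beta b /\ trajectory d x a b y.
Proof.
move=> ux /nonanticipative_cst na.
have : (ereal_inf [set tau | exists b y, [/\ admissibles beta b,
    trajectory d x a b y & tau = entry_time T y]] < +oo)%E.
  by apply: le_lt_trans ux; apply: ereal_sup_ubound; exists (cst a).
by move=> /ereal_inf_lt[_ [b [y [adm tr _]]] _]; exists b, y.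
Qed.

Lemma control0 (a : policy) (b : policies) : control a b (@ord0 m) = a :> (R -> R).
Proof. by rewrite /control unlift_none. Qed.

Lemma control_pursuer (a : policy) (b : policies) (j : 'I_m) :
  control a b (pursuer j) = b j :> (R -> R).
Proof. by rewrite /control /pursuer liftK. Qed.

(** One half of a dynamic programming principle, along a path that starts with
    constant accelerations [c].  The pursuers imitate this path up to time [t]
    and then follow a nearly optimal answer to full thrust [alpha].  The path
    of the evader needs at least the thrust [alpha] and so may exceed what the
    evader can do: it only serves as an upper bound.  Whatever the evader's
    strategy [phi] answers, [motion_le] keeps the evader behind that bound, so
    the pursuer who reaches the bound has caught the evader. *)
Lemma value_along_uniform_path i (x : state R m) (c : 'I_m.+1 -> R) t : 0 <= t ->
  (forall s, 0 <= s <= t ->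
     alpha <= c ord0 + d ord0 (vel x ord0 + s * c ord0)) ->
  (forall s j, 0 <= s <= t -> `|c (pursuer j) +
     d (pursuer j) (vel x (pursuer j) + s * c (pursuer j))| <= beta j) ->
  u i x \is a fin_num -> u i (uniform_path x c t) \is a fin_num ->
  (u i x <= t%:E + u i (uniform_path x c t))%E.
Proof.
move=> t0 c0 cb ux uy; set y := uniform_path x c t in uy *.
have dc := lipschitz_drift_continuous.
have adma : admissible alpha (cst alpha) by apply: admissible_cst; rewrite ger0_norm.
apply/lee_addgt0Pr => e e0; apply: ge_ereal_sup => _ [phi naphi <-].
have : (ereal_inf [set tau | exists b z, [/\ admissibles beta b,
    trajectory d y (cst alpha) b z & tau = entry_time (target_of i) z]] < u i y + e%:E)%E.
  apply: (@le_lt_trans _ _ (u i y)); last by rewrite lteDl ?lte_fin.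
  apply: ereal_sup_ubound; exists (cst (cst alpha)) => //.
  exact: nonanticipative_cst.
(* [bs], [xs]: a nearly optimal continuation after time [t], entering the
   target at its own time [s]. *)
move=> /ereal_inf_lt[_ [bs [xs [admbs trs ->]]]].
move=> /ereal_inf_lt[_ [s [s0 Txs] <-]] sle.
pose a1 (k : 'I_m.+1) := fun r : R => c k + d k (vel x k + r * c k).
have a1c k : continuous (a1 k).
  move=> r; apply: cvgD; first exact: cvg_cst.
  apply: continuous_cvg; first exact: dc.
  by apply: cvgD; [exact: cvg_cst|apply: cvgMr_tmp; exact: cvg_id].
pose b j := concat t (a1 (pursuer j)) (bs j).
have admb : admissibles beta b.
  by move=> j; apply: admissible_concat => // r rt; exact: cb.
have adma0 : admissible alpha (phi b) by exact: naphi.1.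
have uxoo : (u i x < +oo)%E by rewrite ltey_eq ux.
have [b' [x' [admb' tr']]] := finite_value_trajectory uxoo adma0.
(* [Y] is the reference motion; the true motion [X] has the same pursuers, and
   its evader is the one of a trajectory for the control [phi b]. *)
pose Y r : state R m := \matrix_(k, l) concat t
  (fun r => uniform_path x c r k l) (fun r => xs r k l) r.
have posY k : (fun r => pos (Y r) k) = concat t
    (fun r => pos x k + (r * vel x k + r ^+ 2 / 2 * c k)) (fun r => pos (xs r) k).
  by apply/funext => r; rewrite /pos mxE /concat !mxE.
have velY k : (fun r => vel (Y r) k) = concat t
    (fun r => vel x k + r * c k) (fun r => vel (xs r) k).
  by apply/funext => r; rewrite /vel mxE /concat !mxE.
have motY k gamma : admissible gamma (control (cst alpha) bs k) ->
    motion (d k) (pos x k) (vel x k) (concat t (a1 k) (control (cst alpha) bs k))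
      (fun r => pos (Y r) k) (fun r => vel (Y r) k).
  move=> adm; rewrite posY velY; apply: motion_concat => //.
    exact: motion_uniform.
  have := trajectory_motion dc trs adm.
  by rewrite {1}/pos {1}/vel !mxE.
pose X r : state R m := \matrix_(k, l) if k == ord0 then x' r k l else Y r k l.
have posX0 : (fun r => pos (X r) ord0) = (fun r => pos (x' r) ord0).
  by apply/funext => r; rewrite /pos mxE.
have velX0 : (fun r => vel (X r) ord0) = (fun r => vel (x' r) ord0).
  by apply/funext => r; rewrite /vel mxE.
have posX j : (fun r => pos (X r) (pursuer j)) = (fun r => pos (Y r) (pursuer j)).
  by apply/funext => r; rewrite /pos mxE.
have velX j : (fun r => vel (X r) (pursuer j)) = (fun r => vel (Y r) (pursuer j)).
  by apply/funext => r; rewrite /vel mxE.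
have mot0 : motion (d ord0) (pos x ord0) (vel x ord0) (phi b)
    (fun r => pos (X r) ord0) (fun r => vel (X r) ord0).
  rewrite posX0 velX0; have := @trajectory_motion _ _ _ dc alpha _ _ _ _ ord0 tr'.
  by rewrite control0; apply.
have trX : trajectory d x (phi b) b X.
  apply: motion_trajectory => k; case: (unliftP ord0 k) => [j|] ->; last by rewrite control0.
  rewrite -/(pursuer j) control_pursuer posX velX.
  by have := motY (pursuer j) (beta j); rewrite control_pursuer; apply.
have X0Y0 : pos (X (t + s)) ord0 <= pos (Y (t + s)) ord0.
  have motY0 := motY ord0 alpha; rewrite control0 in motY0.
  apply: (motion_le k_d_gt0 (d_lip ord0) mot0 (motY0 adma) _ _).2; last by rewrite addr_ge0.
  have [_] := adma0; apply: (@filterS _ (almost_everywhere mu)) => r ar r0.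
  rewrite /concat; case: ifPn => rt.
    by apply: (le_trans (ler_norm _)); apply: (le_trans (ar r0)); apply: c0; rewrite r0 rt.
  exact: le_trans (ler_norm _) (ar r0).
(* For [s = 0] the concatenation still reads its first branch. *)
have Yts : Y (t + s) = xs s.
  apply/matrixP => k l; rewrite mxE /concat gerDl.
  case: ifPn => ss; last by rewrite addrC addKr.
  by rewrite (_ : s = 0) ?addr0 ?(trajectory_start trs) //; lra.
apply: (@le_trans _ _ (t + s)%:E); last first.
  by rewrite EFinD -addeA leeD2l// ltW.
apply: (@le_trans _ _ (entry_time (target_of i) X)).
  by apply: ereal_inf_lbound; exists b, X.
apply: ereal_inf_lbound; exists (t + s) => //; split; first by rewrite addr_ge0.
rewrite /target_of /= (le_trans X0Y0) //.
have -> : pos (X (t + s)) (pursuer i) = pos (Y (t + s)) (pursuer i).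
  by rewrite /pos mxE.
by rewrite Yts.
Qed.

End Value.

Lemma le0_small_multiples (R : realFieldType) (a K : R) : 0 <= K ->
  (forall e, 0 < e < 1 -> a <= e * K) -> a <= 0.
Proof.
move=> K0 aK; rewrite leNgt; apply/negP => a0.
pose e := a / (2 * (K + 1 + a)).
have D0 : 0 < 2 * (K + 1 + a) by lra.
have e0 : 0 < e by rewrite divr_gt0.
have e1 : e < 1 by rewrite ltr_pdivrMr //; lra.
have := aK e; rewrite e0 e1 => /(_ isT).
rewrite /e mulrAC ler_pdivlMr // => h.
have : a * K < a * (2 * (K + 1 + a)) by rewrite ltr_pM2l //; lra.
by rewrite ltNge h.
Qed.

(** * Semidifferentials and pointwise minima *)

Section Semidifferentials.
Context {R : realType} {k l : nat}.
Local Notation E := 'M[R]_(k.+1, l.+1).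
Implicit Types (u v : E -> R) (x p : E).

(** The limit superior unfolded; the point [y = x] can be included because both
    sides vanish there. *)
Lemma superdiff_near u x p e : superdiff u x p -> 0 < e ->
  \forall y \near x, u y - u x - dotp p (y - x) <= e * `|y - x|.
Proof.
move=> up e0.
have : (limf_esup (diff_quotient u x p) x^' < e%:E)%E.
  by apply: le_lt_trans up _; rewrite lte_fin.
rewrite limf_esupE => /ereal_inf_lt[_ [V xV <-] supV].
have : \forall y \near x, y != x -> V y := xV.
apply: filterS => y Vy; have [->|yx] := eqVneq y x.
  rewrite !subrr normr0 mulr0 /dotp big1 ?subr0 // => i _.
  by rewrite big1 // => j _; rewrite mxE mulr0.
have : (diff_quotient u x p y < e%:E)%E.
  apply: le_lt_trans supV; apply: ereal_sup_ubound; exists y => //; exact: Vy.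
rewrite /diff_quotient lte_fin ltr_pdivrMr; first exact: ltW.
by rewrite normr_gt0 subr_eq0.
Qed.

(** A function touched from below by [u] at [x] has larger difference quotients
    around [x]. *)
Lemma subdiff_le u v x p : u x = v x -> (\forall y \near x, u y <= v y) ->
  subdiff u x p -> subdiff v x p.
Proof.
rewrite /subdiff /= => uvx uv up; apply: le_trans up _.
rewrite !limf_einfE; apply: ge_ereal_sup => _ [V xV <-].
apply: (@le_trans _ _ (ereal_inf (diff_quotient v x p @` (V `&` [set y | u y <= v y])))).
  apply: le_ereal_inf_tmp => _ [y [Vy uvy] <-].
  apply: (@le_trans _ _ (diff_quotient u x p y)).
    by apply: ereal_inf_lbound; exists y.
  rewrite /diff_quotient lee_fin ler_wpM2r ?invr_ge0 // uvx lerD2r lerD2r.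
  exact: uvy.
apply: ereal_sup_ubound; exists (V `&` [set y | u y <= v y]) => //.
apply: filterI => //; exact: cvg_within uv.
Qed.

Lemma pointwise_min_continuous (I : finType) (w : I -> E -> R) (W : E -> R) x :
  (\forall y \near x, (forall i, W y <= w i y) /\ exists i, W y = w i y) ->
  (forall i, {for x, continuous (w i)}) -> {for x, continuous W}.
Proof.
move=> Ww wc; apply/(@cvgrPdist_lt _ _ _ (nbhs x) (nbhs_filter x)) => e e0.
have [Wx [i0 Wi0]] := @nbhs_singleton E x _ Ww.
have : \forall y \near x, forall i, `|w i x - w i y| < e.
  apply: (@filter_forall _ _ _ (nbhs x) (nbhs_filter x)) => i.
  by have /cvgrPdist_lt/(_ _ e0) := wc i.
move=> H; have FF := nbhs_filter x; apply: filterS2 Ww H => y [Wy [j Wj]] H.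
have := H i0; have := H j; have := Wx j; have := Wy i0.
by rewrite !ltr_norml => ? ? /andP[? ?] /andP[? ?]; apply/andP; split; lra.
Qed.

End Semidifferentials.

Section Game.
Context {R : realType} {m : nat}.
Implicit Types (x p : state R m) (u : 'I_m -> state R m -> \bar R).

Lemma open_target_ofC i : open (~` target_of i : set (state R m)).
Proof.
have -> : ~` target_of i =
    (fun x : state R m => x ord0 ord0 - x (pursuer i) ord0) @^-1` [set r | 0 < r].
  by apply/seteqP; split => x /=; rewrite /target_of /= /pos subr_gt0 ltNge => /negP.
apply: open_comp; last exact: open_gt.
move=> x _; apply: (@continuousB _ R (state R m) (fun x => x ord0 ord0)
  (fun x => x (pursuer i) ord0) x); exact: coord_continuous.
Qed.

Lemma open_targetC : open (~` target : set (state R m)).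
Proof.
rewrite openE => x Tx; rewrite /interior.
have : \forall y \near x, forall i, (~` target_of i) y.
  apply: (@filter_forall _ _ _ (nbhs x) (nbhs_filter x)) => i.
  apply: open_nbhs_nbhs; split; first exact: open_target_ofC.
  by move=> xi; apply: Tx; exists i.
by apply: filterS => y H [i _]; exact: H.
Qed.

Lemma min_value_le u x i : (min_value u x <= u i x)%E.
Proof. exact: bigmin_le. Qed.

Lemma min_value_attained u x : (0 < m)%N -> exists i, min_value u x = u i x.
Proof.
move=> m0; have [i _ mini] := @eq_bigmin _ _ _ _ (Ordinal m0) predT (fun i => u i x) isT
  (fun i _ => leey _).
by exists i; exact: mini.
Qed.

Lemma min_value_fine u : (0 < m)%N ->
  (forall i x, (~` target_of i) x -> u i x \is a fin_num) ->
  forall x, (~` target) x ->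
    [/\ min_value u x \is a fin_num,
        forall i, fine (min_value u x) <= fine (u i x) &
        exists i, fine (min_value u x) = fine (u i x)].
Proof.
move=> m0 ufin x Tx.
have {}ufin i : u i x \is a fin_num.
  by apply: ufin => xi; apply: Tx; exists i.
have [j minj] := min_value_attained u x m0.
split; first by rewrite minj.
- by move=> i; apply: fine_le => //; [rewrite minj|exact: min_value_le].
- by exists j; rewrite minj.
Qed.

End Game.

(** * The subsolution inequality *)

Section Subsolution.
Context {R : realType} {m : nat}.
Implicit Types (x p : state R m) (c : 'I_m.+1 -> R) (t : R).

Lemma dotp_state p v : dotp p v =
  \sum_i (p i ord0 * v i ord0 + p i ord_max * v i ord_max).
Proof.
apply: eq_bigr => i _; rewrite !big_ord_recl big_ord0 addr0.
by congr (_ + _ * _); congr (_ i _); exact: val_inj.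
Qed.

Definition uniform_velocity x c : state R m :=
  \matrix_(i, j) if j == ord0 then vel x i else c i.

(** The second-order coefficient of [uniform_path] in time. *)
Definition uniform_curvature c : state R m :=
  \matrix_(i, j) if j == ord0 then c i / 2 else 0.

Lemma uniform_path_expansion x c t : uniform_path x c t - x =
  t *: (uniform_velocity x c + t *: uniform_curvature c).
Proof.
apply/matrixP => i j; rewrite !mxE.
have [->|->] := ord2_cases j.
- by rewrite eqxx /pos; field.
- by rewrite /= /vel; ring.
Qed.

Lemma uniform_path_cvg x c : uniform_path x c t @[t --> (0 : R)] --> x.
Proof.
rewrite -[X in _ --> X](addr0 x).
have -> : uniform_path x c = fun t => x + t *: (uniform_velocity x c + t *: uniform_curvature c).
  by apply/funext => t; rewrite -uniform_path_expansion addrC subrK.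
apply: cvgD; first exact: cvg_cst.
rewrite -[X in _ --> X](scale0r (uniform_velocity x c + (0:R) *: uniform_curvature c)).
apply: cvgZ; first exact: cvg_id.
apply: cvgD; first exact: cvg_cst.
by apply: cvgZr_tmp; exact: cvg_id.
Qed.

(** A function that decreases no faster than time along the path has slope at
    least [-1] in its initial direction, and an element of the superdifferential
    bounds that slope from above. *)
Lemma superdiff_along_uniform_path (W : state R m -> R) x p c :
  superdiff W x p ->
  (\forall t \near 0^'+, W x <= t + W (uniform_path x c t)) ->
  0 <= 1 + \sum_i (p i ord0 * vel x i + p i ord_max * c i).
Proof.
move=> Wp xW.
set f := uniform_velocity x c; set g := uniform_curvature c.
have -> : \sum_i (p i ord0 * vel x i + p i ord_max * c i) = dotp p f.
  by rewrite dotp_state; apply: eq_bigr => i _; rewrite !mxE.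
rewrite -oppr_le0; apply: (@le0_small_multiples _ _ (`|dotp p g| + `|f| + `|g|)).
  by rewrite !addr_ge0.
move=> e /andP[e0 e1].
have Wy := cvg_at_right_filter (@uniform_path_cvg x c) (superdiff_near Wp e0).
have [t [t0 te xWt Wyt]] : exists t, [/\ 0 < t, t < e,
    W x <= t + W (uniform_path x c t) &
    W (uniform_path x c t) - W x - dotp p (uniform_path x c t - x)
      <= e * `|uniform_path x c t - x|].
  apply: (@filter_ex _ (0^'+ : set_system R)).
  near=> t; split; [|by near: t; exact: nbhs_right_lt|by near: t|by near: t] => //.
move: Wyt; rewrite uniform_path_expansion -/f -/g.
have -> : dotp p (t *: (f + t *: g)) = t * (dotp p f + t * dotp p g).
  rewrite !dotp_state mulrDr !mulr_sumr -big_split /=.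
  by apply: eq_bigr => i _; rewrite !mxE; ring.
rewrite normrZ (gtr0_norm t0) => Wyt.
have nfg : `|f + t *: g| <= `|f| + t * `|g|.
  by rewrite (le_trans (ler_normD _ _)) // normrZ (gtr0_norm t0).
have : t * (- 1 - (dotp p f + t * dotp p g)) <= t * (e * (`|f| + t * `|g|)).
  have : e * (t * `|f + t *: g|) <= t * (e * (`|f| + t * `|g|)).
    by rewrite mulrCA ler_pM2l // ler_pM2l.
  lra.
rewrite ler_pM2l // => h.
have : t * dotp p g <= e * `|dotp p g|.
  apply: le_trans (_ : t * `|dotp p g| <= _); first by rewrite ler_pM2l // ler_norm.
  by rewrite ler_wpM2r // ltW.
have : e * (t * `|g|) <= e * `|g|.
  by rewrite ler_pM2l // ler_piMl // ltW // (lt_trans te).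
lra.
Unshelve. all: by end_near. Qed.

End Subsolution.

Section Final.
Context {R : realType} {m : nat}.
Variables (d : 'I_m.+1 -> R -> R) (k_d alpha : R) (beta : 'I_m -> R).
Hypothesis m_gt0 : (0 < m)%N.
Hypothesis k_d_gt0 : 0 < k_d.
Hypothesis d_lip : forall i y y', `|d i y - d i y'| <= k_d * `|y - y'|.
Hypothesis alpha_gt0 : 0 < alpha.
Hypothesis beta_gt0 : forall i, 0 < beta i.

Local Notation u := (fun i => upper_value d alpha beta (target_of i)).
Hypothesis u_fin : forall i x, (~` target_of i) x -> u i x \is a fin_num.

(** The control [c + d i (v + s * c)] that realises the constant acceleration
    [c] drifts with [s]; an open constraint met at [s = 0] survives a short
    time. *)
Lemma open_control_short_time (i : 'I_m.+1) (v c : R) (P : R -> Prop) :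
  open P -> P (c + d i v) ->
  \forall t \near 0^'+, forall s, 0 <= s <= t -> P (c + d i (v + s * c)).
Proof.
move=> oP Pc.
have cont : c + d i (v + s * c) @[s --> (0 : R)] --> c + d i v.
  apply: cvgD; first exact: cvg_cst.
  apply: continuous_cvg; first exact: (lipschitz_drift_continuous k_d_gt0 d_lip).
  rewrite -[X in _ --> X]addr0 -[X in _ --> _ + X](mul0r c).
  apply: cvgD; first exact: cvg_cst.
  by apply: cvgMr_tmp; exact: cvg_id.
have /cont/nbhs_ballP[e /= e0 He] : nbhs (c + d i v) P by exact: open_nbhs_nbhs.
near=> t => s /andP[s0 st]; apply: He.
rewrite /ball /= sub0r normrN ger0_norm // (le_lt_trans st) //.
Unshelve. all: by end_near. Qed.

(** The first steps of all pursuers and of the evader are shared by the games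
    with targets [target_of j], since full thrust is the evader's best answer to
    every pursuer at once.  The inequality for the pursuer [j] that is optimal
    at the end of the path therefore passes to the minimum. *)
Lemma min_value_along_uniform_path x (c : 'I_m.+1 -> R) : (~` target) x ->
  alpha < c ord0 + d ord0 (vel x ord0) ->
  (forall j, `|c (pursuer j) + d (pursuer j) (vel x (pursuer j))| < beta j) ->
  \forall t \near 0^'+,
    fine (min_value u x) <= t + fine (min_value u (uniform_path x c t)).
Proof.
move=> Tx c0 cb.
have outside : \forall t \near 0^'+, (~` target) (uniform_path x c t).
  apply: (cvg_at_right_filter (@uniform_path_cvg _ _ x c) (_ : nbhs x (~` target))).
  by apply: open_nbhs_nbhs; split => //; exact: open_targetC.
have evader : \forall t \near 0^'+, forall s, 0 <= s <= t ->
    alpha < c ord0 + d ord0 (vel x ord0 + s * c ord0).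
  exact: (open_control_short_time (open_gt (y := alpha)) c0).
have pursuers : \forall t \near 0^'+, forall j s, 0 <= s <= t ->
    `|c (pursuer j) + d (pursuer j) (vel x (pursuer j) + s * c (pursuer j))| < beta j.
  apply: filter_forall => j.
  apply: (@open_control_short_time _ _ _ [set r : R | `|r| < beta j]) (cb j).
  by apply: (@open_comp _ _ (fun r : R => `|r|) [set r | r < beta j]);
    [move=> r _; exact: norm_continuous|exact: open_lt].
near=> t.
have out : (~` target) (uniform_path x c t) by near: t.
have [_ minx _] := min_value_fine m_gt0 u_fin Tx.
have [_ _ [j ->]] := min_value_fine m_gt0 u_fin out.
apply: le_trans (minx j) _.
have fx : u j x \is a fin_num by apply: u_fin => xj; apply: Tx; exists j.
have fy : u j (uniform_path x c t) \is a fin_num.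
  by apply: u_fin => xj; apply: out; exists j.
rewrite -lee_fin EFinD !fineK //.
apply: (value_along_uniform_path k_d_gt0 d_lip) => //.
- exact: ltW.
- by move=> s st; apply: ltW; move: s st; near: t.
- by move=> s i st; apply: ltW; move: i s st; near: t.
Unshelve. all: by end_near. Qed.

(** The Hamiltonian at [p] is at most the one where [alpha * `|p ord0 ord_max|]
    is replaced by [alpha * p ord0 ord_max], that is, where the evader uses the
    control [alpha] instead of the minimising one; the pursuers use
    [- beta j * sg p].  The path lemma needs strict constraints on the controls,
    so these are perturbed by [e], which then tends to 0. *)
Lemma hamiltonian_le0 x p : (~` target) x ->
  superdiff (fine \o min_value u) x p -> hamiltonian d alpha beta x p <= 0.
Proof.
move=> Tx up.
apply: (@le0_small_multiples _ _ (`|p ord0 ord_max| +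
    \sum_j beta j * `|p (pursuer j) ord_max|)).
  by rewrite addr_ge0 // sumr_ge0 // => j _; rewrite mulr_ge0 // ltW.
move=> e /andP[e0 e1].
pose c (i : 'I_m.+1) := - d i (vel x i) +
  if unlift ord0 i is Some j then - ((1 - e) * beta j * Num.sg (p i ord_max))
  else alpha + e.
have c0 : c ord0 = - d ord0 (vel x ord0) + (alpha + e) by rewrite /c unlift_none.
have cj j : c (pursuer j) = - d (pursuer j) (vel x (pursuer j)) -
    (1 - e) * beta j * Num.sg (p (pursuer j) ord_max).
  by rewrite /c /pursuer liftK.
have := superdiff_along_uniform_path up (min_value_along_uniform_path Tx (c := c) _ _).
have h0 : alpha < c ord0 + d ord0 (vel x ord0) by rewrite c0; lra.
have hj j : `|c (pursuer j) + d (pursuer j) (vel x (pursuer j))| < beta j.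
  rewrite cj addrAC addNr add0r normrN normrM ger0_norm; last first.
    by rewrite mulr_ge0 ?subr_ge0 ?ltW.
  rewrite normr_sg (@le_lt_trans _ _ ((1 - e) * beta j)) //.
    rewrite ler_piMr //; first by rewrite mulr_ge0 ?subr_ge0 ?ltW.
    by case: (_ == 0); rewrite ?ler01.
  by rewrite gtr_pMl // ltrBlDr ltrDl.
pose B := \sum_(j < m) (- (p (pursuer j) ord0 * vel x (pursuer j)) +
  p (pursuer j) ord_max * d (pursuer j) (vel x (pursuer j))).
pose C := \sum_(j < m) beta j * `|p (pursuer j) ord_max|.
have -> : hamiltonian d alpha beta x p = - (p ord0 ord0 * vel x ord0) +
    p ord0 ord_max * d ord0 (vel x ord0) + B - alpha * `|p ord0 ord_max| + C - 1.
  by rewrite /hamiltonian big_ord_recl.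
have speedE : \sum_i (p i ord0 * vel x i + p i ord_max * c i) =
    p ord0 ord0 * vel x ord0 + p ord0 ord_max * c ord0 + (- B - (1 - e) * C).
  rewrite big_ord_recl; congr (_ + _).
  rewrite /B /C mulr_sumr -!sumrN -big_split /=; apply: eq_bigr => j _.
  by rewrite -/(pursuer j) cj normrEsg; ring.
move=> /(_ h0 hj); rewrite speedE c0 -/C.
have : p ord0 ord_max <= `|p ord0 ord_max| by exact: ler_norm.
move=> pn h.
have : alpha * p ord0 ord_max <= alpha * `|p ord0 ord_max| by rewrite ler_pM2l.
have : e * p ord0 ord_max <= e * `|p ord0 ord_max| by rewrite ler_pM2l.
lra.
Qed.

End Final.

Theorem proposition3p2 (R : realType) (m : nat) (d : 'I_m.+1 -> R -> R)
    (k_d c_d alpha : R) (beta : 'I_m -> R)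
    (m_ge1 : (1 <= m)%N)
    (k_d_gt0 : 0 < k_d) (c_d_gt0 : 0 < c_d)
    (d_lip : forall i y y', `|d i y - d i y'| <= k_d * `|y - y'|)
    (d_le : forall i y, d i y <= c_d)
    (alpha_gt0 : 0 < alpha) (beta_gt0 : forall i, 0 < beta i)
    (beta_gt : forall i, alpha + 2 * c_d < beta i) :
  let F2 := hamiltonian d alpha beta in
  let u i := upper_value d alpha beta (target_of i) in
  (forall i, eviscosity_solution F2 (~` target_of i) (u i)) ->
  (forall (i j : 'I_m) (x : state R m), i != j ->
     (~` target) x -> u i x = u j x ->
     exists2 U : set (state R m), nbhs x U &
       [lipschitz (fine (u i y)) | y in U] /\
       [lipschitz (fine (u j y)) | y in U]) ->
  eviscosity_solution F2 (~` target) (min_value u).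
Proof.
move=> F2 u visc _.
have u_fin i x : (~` target_of i) x -> u i x \is a fin_num by exact: (visc i).1.
have u_cont i x : (~` target_of i) x -> {for x, continuous (fine \o u i)}.
  have [_ [+ _]] := visc i; rewrite continuous_open_subspace; last exact: open_target_ofC.
  by move=> uc xi; apply: uc; rewrite inE.
have min_near x : (~` target) x -> \forall y \near x,
    (forall i, fine (min_value u y) <= fine (u i y)) /\
    exists i, fine (min_value u y) = fine (u i y).
  move=> Tx; have : nbhs x (~` target).
    by apply: open_nbhs_nbhs; split => //; exact: open_targetC.
  by apply: filterS => y /(min_value_fine m_ge1 u_fin)[].
split; first by move=> x /(min_value_fine m_ge1 u_fin)[].
split.
  rewrite continuous_open_subspace; last exact: open_targetC.
  move=> x; rewrite inE => Tx.
  apply: (@pointwise_min_continuous _ _ _ _ (fun i => fine \o u i)) (min_near x Tx) _.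
  by move=> i; apply: u_cont => xi; apply: Tx; exists i.
move=> x Tx; split=> p up.
  exact: (hamiltonian_le0 m_ge1 k_d_gt0 d_lip alpha_gt0 beta_gt0 u_fin Tx up).
have [_ _ [i mini]] := min_value_fine m_ge1 u_fin Tx.
have [_ [_ /(_ x)]] := visc i.
move=> /(_ _)[|_]; first by move=> xi; apply: Tx; exists i.
apply; apply: (subdiff_le _ _ up); first exact: mini.
by apply: filterS (min_near x Tx) => y [le_u _]; exact: le_u.
Qed.
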